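(* Let $H$ be the ring of Hurwitz integers, let $\boldsymbol\alpha,\boldsymbol\beta\in\mathbb H^2$ be linearly independent (for left multiplication by scalars of $\mathbb H$), and let $\mathcal L_H=\{n_1\boldsymbol\alpha+n_2\boldsymbol\beta:n_1,n_2\in H\}$. Suppose $\{\boldsymbol\alpha,\boldsymbol\beta\}$ is a greedy basis, i.e. $$\|\boldsymbol\alpha\|\le\|\boldsymbol\beta\|\quad\text{and}\quad\|\boldsymbol\beta+n\boldsymbol\alpha\|\ge\|\boldsymbol\beta\|\ \text{ for all }n\in H.$$ Then $\{\boldsymbol\alpha,\boldsymbol\beta\}$ is a shortest reduced basis of $\mathcal L_H$: $\boldsymbol\alpha$ is a shortest nonzero vector of $\mathcal L_H$, and $\boldsymbol\beta$ is a shortest vector among the vectors of $\mathcal L_H$ linearly independent (over $\mathbb H$) from $\boldsymbol\alpha$.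
   Context: The Hurwitz integers $H$ are the quaternions $a_0+a_1\mathrm i+a_2\mathrm j+a_3\mathrm k$ with $a_0,\dots,a_3$ either all integers or all half-integers (elements of $\mathbb Z+\tfrac12$). For $\mathbf v=(v_1,v_2)\in\mathbb H^2$, $\|\mathbf v\|=(|v_1|^2+|v_2|^2)^{1/2}$ with $|\cdot|$ the quaternion absolute value. *)

(* Defs.v *)
(* The reals are an arbitrary R : realType. *)
From HB Require Import structures.
From mathcomp Require Import all_boot all_order all_algebra.
From mathcomp Require Import ring.
From mathcomp Require Import classical_sets reals.
Set Implicit Arguments.
Unset Strict Implicit.
Unset Printing Implicit Defensive.
Import Order.TTheory GRing.Theory Num.Theory.
Local Open Scope ring_scope.

(* Quat a0 a1 a2 a3 is a0 + a1 i + a2 j + a3 k. *)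
Record quat (R : Type) := Quat { q0 : R; q1 : R; q2 : R; q3 : R }.

Section QuatChoice.
Variable R : Type.

Definition quat_to_prod (x : quat R) : R * R * R * R :=
  (q0 x, q1 x, q2 x, q3 x).

Definition quat_of_prod (t : R * R * R * R) : quat R :=
  let: (a, b, c, d) := t in Quat a b c d.

Lemma quat_to_prodK : cancel quat_to_prod quat_of_prod.
Proof. by case. Qed.
End QuatChoice.

HB.instance Definition _ (R : eqType) :=
  Equality.copy (quat R) (can_type (@quat_to_prodK R)).
HB.instance Definition _ (R : choiceType) :=
  Choice.copy (quat R) (can_type (@quat_to_prodK R)).

Section QuatRing.
Variable R : comNzRingType.
Implicit Types x y z : quat R.

Definition quat_zero : quat R := Quat 0 0 0 0.
Definition quat_one : quat R := Quat 1 0 0 0.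
Definition quat_opp x : quat R := Quat (- q0 x) (- q1 x) (- q2 x) (- q3 x).
Definition quat_add x y : quat R :=
  Quat (q0 x + q0 y) (q1 x + q1 y) (q2 x + q2 y) (q3 x + q3 y).
(* Hamilton's product: i^2 = j^2 = k^2 = ijk = -1. *)
Definition quat_mul x y : quat R :=
  Quat (q0 x * q0 y - q1 x * q1 y - q2 x * q2 y - q3 x * q3 y)
       (q0 x * q1 y + q1 x * q0 y + q2 x * q3 y - q3 x * q2 y)
       (q0 x * q2 y - q1 x * q3 y + q2 x * q0 y + q3 x * q1 y)
       (q0 x * q3 y + q1 x * q2 y - q2 x * q1 y + q3 x * q0 y).

Fact quat_addA : associative quat_add.
Proof. by move=> x y z; rewrite /quat_add /= !addrA. Qed.
Fact quat_addC : commutative quat_add.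
Proof. by move=> x y; congr Quat; apply: addrC. Qed.
Fact quat_add0 : left_id quat_zero quat_add.
Proof. by case=> a b c d; rewrite /quat_add /= !add0r. Qed.
Fact quat_addN : left_inverse quat_zero quat_opp quat_add.
Proof. by move=> x; rewrite /quat_add /= !addNr. Qed.

HB.instance Definition _ := GRing.isZmodule.Build (quat R)
  quat_addA quat_addC quat_add0 quat_addN.

Fact quat_mulA : associative quat_mul.
Proof. by move=> x y z; congr Quat => /=; ring. Qed.
Fact quat_mul1 : left_id quat_one quat_mul.
Proof. by case=> a b c d; congr Quat => /=; ring. Qed.
Fact quat_mulr1 : right_id quat_one quat_mul.
Proof. by case=> a b c d; congr Quat => /=; ring. Qed.
Fact quat_mulDl : left_distributive quat_mul quat_add.
Proof. by move=> x y z; congr Quat => /=; ring. Qed.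
Fact quat_mulDr : right_distributive quat_mul quat_add.
Proof. by move=> x y z; congr Quat => /=; ring. Qed.
Fact quat_one_neq0 : quat_one != 0 :> quat R.
Proof. by apply/eqP => -[] /eqP; rewrite oner_eq0. Qed.

HB.instance Definition _ := GRing.Zmodule_isNzRing.Build (quat R)
  quat_mulA quat_mul1 quat_mulr1 quat_mulDl quat_mulDr quat_one_neq0.
End QuatRing.

Section Lattices.
Variable R : realType.

Definition half_integer : pred R := [pred x | x - 2^-1 \is a Num.int].

Definition hurwitz : pred (quat R) := [pred x |
     [&& q0 x \is a Num.int, q1 x \is a Num.int,
         q2 x \is a Num.int & q3 x \is a Num.int]
  || [&& q0 x \in half_integer, q1 x \in half_integer,
         q2 x \in half_integer & q3 x \in half_integer]].

Definition qabs (x : quat R) : R :=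
  Num.sqrt (q0 x ^+ 2 + q1 x ^+ 2 + q2 x ^+ 2 + q3 x ^+ 2).

(* *: acts on row vectors by entrywise left multiplication, so this is
   the left module H^2. *)
Local Notation V := 'rV[quat R]_2.
Implicit Types (u v a b : V) (L : set V).

Definition vnorm v : R := Num.sqrt (\sum_(i < 2) qabs (v 0 i) ^+ 2).

Definition lin_indep u v : Prop :=
  forall c d : quat R, c *: u + d *: v = 0 -> c = 0 /\ d = 0.

Definition hurwitz_lattice a b : set V :=
  [set v | exists n1 n2 : quat R,
     [/\ n1 \in hurwitz, n2 \in hurwitz & v = n1 *: a + n2 *: b]].

Definition greedy_basis a b : Prop :=
  vnorm a <= vnorm b /\
  (forall n : quat R, n \in hurwitz -> vnorm b <= vnorm (b + n *: a)).

Definition lattice_basis L a b : Prop :=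
  lin_indep a b /\ L = hurwitz_lattice a b.

Definition shortest_nonzero L a : Prop :=
  [/\ L a, a <> 0 & forall v, L v -> v <> 0 -> vnorm a <= vnorm v].

Definition shortest_indep L a b : Prop :=
  [/\ L b, lin_indep a b &
      forall v, L v -> lin_indep a v -> vnorm b <= vnorm v].

Definition shortest_reduced_basis L a b : Prop :=
  [/\ lattice_basis L a b, shortest_nonzero L a & shortest_indep L a b].
End Lattices.

(* Main.v *)
Require Import Defs.
From mathcomp Require Import all_boot all_order all_algebra.
From mathcomp Require Import classical_sets reals.
From mathcomp Require Import ring lra.
Set Implicit Arguments.
Unset Strict Implicit.
Unset Printing Implicit Defensive.
Import Order.TTheory GRing.Theory Num.Theory.
Local Open Scope ring_scope.

(** Decompose beta = c alpha + beta' with beta' orthogonal to alpha for the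
    quaternionic Hermitian form.  Writing |.|^2 for squared norms, a lattice
    vector satisfies
      |n1 alpha + n2 beta|^2 = |n1 + n2 c|^2 |alpha|^2 + |n2|^2 |beta'|^2
    ([sqnorm_combination]).  The condition |beta + n alpha| >= |beta| therefore
    says that c is at least as close to 0 as to any other Hurwitz integer.  The
    Voronoi cell of 0 for the Hurwitz integers is a 24-cell, contained in the
    ball |c|^2 <= 1/2 ([voronoi_norm_le]).  Together with
    |alpha|^2 <= |beta|^2 = |c|^2 |alpha|^2 + |beta'|^2 this gives
    |beta'|^2 >= |alpha|^2 / 2 >= |c|^2 |alpha|^2.

    The heart of the proof is that |n1 alpha + n2 beta| >= |beta| as soon as
    n2 <> 0 ([greedy_lower_bound]).  Norms of Hurwitz integers are natural
    numbers, so there are two cases.  If |n2|^2 >= 2, then the second summand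
    alone is at least 2 |beta'|^2 >= |beta'|^2 + |c|^2 |alpha|^2 = |beta|^2.  If
    |n2|^2 = 1, then n2 is a unit of the Hurwitz ring and
    |n1 + n2 c| = |c + n2^-1 n1| >= |c|.

    Vectors with n2 = 0 are n1 alpha, of norm |n1| |alpha| >= |alpha| unless
    n1 = 0; both minimality claims follow. *)

(** * Conjugation and the norm form on quaternions *)

Section QuatNorm.
Variable R : comNzRingType.
Implicit Types (x y : quat R) (r : R).

Definition qconj x : quat R := Quat (q0 x) (- q1 x) (- q2 x) (- q3 x).
Definition qnorm x : R := q0 x ^+ 2 + q1 x ^+ 2 + q2 x ^+ 2 + q3 x ^+ 2.
Definition qreal r : quat R := Quat r 0 0 0.

Lemma q0D x y : q0 (x + y) = q0 x + q0 y. Proof. by []. Qed.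
Lemma q1D x y : q1 (x + y) = q1 x + q1 y. Proof. by []. Qed.
Lemma q2D x y : q2 (x + y) = q2 x + q2 y. Proof. by []. Qed.
Lemma q3D x y : q3 (x + y) = q3 x + q3 y. Proof. by []. Qed.
Lemma q0M x y : q0 (x * y) =
  q0 x * q0 y - q1 x * q1 y - q2 x * q2 y - q3 x * q3 y.
Proof. by []. Qed.
Lemma q1M x y : q1 (x * y) =
  q0 x * q1 y + q1 x * q0 y + q2 x * q3 y - q3 x * q2 y.
Proof. by []. Qed.
Lemma q2M x y : q2 (x * y) =
  q0 x * q2 y - q1 x * q3 y + q2 x * q0 y + q3 x * q1 y.
Proof. by []. Qed.
Lemma q3M x y : q3 (x * y) =
  q0 x * q3 y + q1 x * q2 y - q2 x * q1 y + q3 x * q0 y.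
Proof. by []. Qed.
Definition quatE := (q0D, q1D, q2D, q3D, q0M, q1M, q2M, q3M).

Lemma quat_eqP x y :
  q0 x = q0 y -> q1 x = q1 y -> q2 x = q2 y -> q3 x = q3 y -> x = y.
Proof. by case: x y => [????] [????] /= -> -> -> ->. Qed.

Lemma qconjM x y : qconj (x * y) = qconj y * qconj x.
Proof. by apply: quat_eqP; rewrite /= ?quatE /=; ring. Qed.

Lemma qnormM x y : qnorm (x * y) = qnorm x * qnorm y.
Proof. by rewrite /qnorm !quatE; ring. Qed.

Lemma qnormD x y : qnorm (x + y) = qnorm x + qnorm y + q0 (x * qconj y) *+ 2.
Proof. by rewrite /qnorm !quatE /=; ring. Qed.

Lemma qnorm_conj x : qnorm (qconj x) = qnorm x.
Proof. by rewrite /qnorm /=; ring. Qed.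

Lemma mul_qconj x : x * qconj x = qreal (qnorm x).
Proof. by apply: quat_eqP; rewrite ?quatE /qnorm /=; ring. Qed.

Lemma qconj_mul x : qconj x * x = qreal (qnorm x).
Proof. by apply: quat_eqP; rewrite ?quatE /qnorm /=; ring. Qed.

Lemma qrealD r s : qreal (r + s) = qreal r + qreal s.
Proof. by apply: quat_eqP; rewrite ?quatE /=; ring. Qed.

Lemma qrealM r s : qreal (r * s) = qreal r * qreal s.
Proof. by apply: quat_eqP; rewrite ?quatE /=; ring. Qed.

End QuatNorm.

(** * The Hermitian form on row vectors *)

Section Hermitian.
Variables (R : comNzRingType) (d : nat).
Implicit Types (u v : 'rV[quat R]_d) (a b : quat R).

Definition herm u v : quat R := \sum_i u 0 i * qconj (v 0 i).
Definition sqnorm u : R := \sum_i qnorm (u 0 i).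

Lemma sqnormD u v : sqnorm (u + v) = sqnorm u + sqnorm v + q0 (herm u v) *+ 2.
Proof.
rewrite /sqnorm /herm (big_morph (@q0 R) (@q0D R) (erefl _)).
rewrite -sumrMnl -!big_split /=; apply: eq_bigr => i _.
by rewrite mxE qnormD.
Qed.

Lemma sqnormZ a u : sqnorm (a *: u) = qnorm a * sqnorm u.
Proof.
by rewrite /sqnorm mulr_sumr; apply: eq_bigr => i _; rewrite mxE qnormM.
Qed.

Lemma hermDl u u' v : herm (u + u') v = herm u v + herm u' v.
Proof. by rewrite -big_split; apply: eq_bigr => i _; rewrite mxE mulrDl. Qed.

Lemma hermZ a b u v : herm (a *: u) (b *: v) = a * herm u v * qconj b.
Proof.
rewrite /herm mulr_sumr mulr_suml; apply: eq_bigr => i _.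
by rewrite !mxE qconjM !mulrA.
Qed.

Lemma hermZl a u v : herm (a *: u) v = a * herm u v.
Proof. by rewrite /herm mulr_sumr; apply: eq_bigr => i _; rewrite mxE mulrA. Qed.

Lemma herm_diag u : herm u u = qreal (sqnorm u).
Proof.
rewrite /herm /sqnorm (big_morph (@qreal R) (@qrealD R) (erefl _)).
by apply: eq_bigr => i _; rewrite mul_qconj.
Qed.

(** The scalar [n1 + n2 c] is the coordinate of [n1 u + n2 v] along [u]. *)
Lemma sqnorm_combination u v (c : quat R) (n1 n2 : quat R) :
  herm (v - c *: u) u = 0 ->
  sqnorm (n1 *: u + n2 *: v) =
    qnorm (n1 + n2 * c) * sqnorm u + qnorm n2 * sqnorm (v - c *: u).
Proof.
move=> orth.
have -> : n1 *: u + n2 *: v = n2 *: (v - c *: u) + (n1 + n2 * c) *: u.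
  by rewrite scalerBr scalerDl scalerA addrCA subrK.
by rewrite [LHS]sqnormD hermZ orth mulr0 mul0r mul0rn addr0 !sqnormZ addrC.
Qed.

End Hermitian.

(** * Orthogonal projection *)

Section Projection.
Variables (R : realFieldType) (d : nat).
Implicit Types (u v : 'rV[quat R]_d).

Lemma qnorm_ge0 (x : quat R) : 0 <= qnorm x.
Proof. by rewrite /qnorm !addr_ge0 ?sqr_ge0. Qed.

Lemma qnorm_eq0 (x : quat R) : qnorm x = 0 -> x = 0.
Proof.
move=> /eqP; rewrite /qnorm !paddr_eq0 ?addr_ge0 ?sqr_ge0 // !sqrf_eq0.
by move=> /andP[/andP[/andP[/eqP ? /eqP ?] /eqP ?] /eqP ?]; apply: quat_eqP.
Qed.

Lemma sqnorm_ge0 u : 0 <= sqnorm u.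
Proof. by apply: sumr_ge0 => i _; apply: qnorm_ge0. Qed.

Lemma sqnorm_gt0 u : u != 0 -> 0 < sqnorm u.
Proof.
move=> u0; rewrite lt_def sqnorm_ge0 andbT; apply: contra u0 => /eqP.
move/psumr_eq0P => u0; apply/eqP/rowP => i; rewrite mxE.
by apply/qnorm_eq0/u0 => // j _; apply: qnorm_ge0.
Qed.

Lemma orth_projection u v : u != 0 -> exists c, herm (v - c *: u) u = 0.
Proof.
move=> /sqnorm_gt0 u0; exists (herm v u * qreal (sqnorm u)^-1).
rewrite -scaleNr hermDl hermZl herm_diag mulNr -mulrA -qrealM.
by rewrite mulVf ?gt_eqF// mulr1 subrr.
Qed.

End Projection.

(** * Hurwitz integers *)

Section Hurwitz.
Variable R : realType.
Implicit Types (x y n : quat R).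

(** Coordinates in the Z-basis (1 + i + j + k) / 2, i, j, k; unlike the
    definition by cases they make closure properties polynomial identities
    with integer coefficients. *)
Definition hurwitz_comb (a b c d : int) : quat R :=
  Quat (a%:~R / 2) (a%:~R / 2 + b%:~R) (a%:~R / 2 + c%:~R) (a%:~R / 2 + d%:~R).

Lemma hurwitz_combP x :
  reflect (exists a b c d, x = hurwitz_comb a b c d) (x \in @hurwitz R).
Proof.
apply: (iffP idP).
  case: x => x0 x1 x2 x3.
  case/orP => /and4P[] /= /intrP[a ea] /intrP[b eb] /intrP[c ec] /intrP[d ed].
    exists (a * 2), (b - a), (c - a), (d - a).
    by rewrite ea eb ec ed /hurwitz_comb !rmorphM !rmorphB /=; congr Quat; field.
  exists (a * 2 + 1), (b - a), (c - a), (d - a).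
  move/eqP: ea eb ec ed; rewrite subr_eq => /eqP -> /eqP.
  rewrite subr_eq => /eqP -> /eqP; rewrite subr_eq => /eqP -> /eqP.
  rewrite subr_eq => /eqP ->; rewrite /hurwitz_comb !(rmorphD, rmorphM, rmorphB) /=.
  by congr Quat; field.
move=> [a [b [c [d ->]]]]; rewrite inE /=.
(* integer or half-integer coordinates according to the parity of [a] *)
have [q [r [-> r01]]] : exists q r : int, a = q * 2 + r /\ (r = 0 \/ r = 1).
  exists (a %/ 2)%Z, (a %% 2)%Z; split; first exact: divz_eq.
  have : (0 <= a %% 2 < 2)%Z by rewrite modz_ge0 //= ltz_pmod.
  by case: (a %% 2)%Z => [[|[|k]]|k] //; [left | right].
have half : ((q * 2 + r)%:~R / 2 : R) = q%:~R + r%:~R / 2.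
  by rewrite rmorphD rmorphM /=; field.
case: r01 => er; rewrite !half // er; apply/orP; [left | right].
  by rewrite mul0r addr0 -!rmorphD /= !intr_int.
have sub (m : int) : (q%:~R + 1%:~R / 2 + m%:~R - 2^-1 : R) = (q + m)%:~R.
  by rewrite rmorphD /=; field.
rewrite !inE !sub !intr_int !andbT.
suff -> : (q%:~R + 1%:~R / 2 - 2^-1 : R) = q%:~R by rewrite intr_int.
by field.
Qed.

Lemma hurwitz_conj x : x \in @hurwitz R -> qconj x \in @hurwitz R.
Proof.
move=> /hurwitz_combP[a [b [c [d ->]]]]; apply/hurwitz_combP.
exists a, (- a - b), (- a - c), (- a - d).
by apply: quat_eqP; rewrite /= ?rmorphB ?rmorphN /=; field.
Qed.

Lemma hurwitzM x y :
  x \in @hurwitz R -> y \in @hurwitz R -> x * y \in @hurwitz R.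
Proof.
move=> /hurwitz_combP[a [b [c [d ->]]]] /hurwitz_combP[a' [b' [c' [d' ->]]]].
apply/hurwitz_combP; set dot := b * b' + c * c' + d * d'.
exists (- (a * a') - a * (b' + c' + d') - a' * (b + c + d) - dot * 2).
exists (a * a' + a * (b' + d') + a' * (b + c) + (c * d' - d * c') + dot).
exists (a * a' + a * (c' + b') + a' * (c + d) + (d * b' - b * d') + dot).
exists (a * a' + a * (d' + c') + a' * (d + b) + (b * c' - c * b') + dot).
rewrite /dot; apply: quat_eqP; rewrite !quatE /=.
all: rewrite !(rmorphD, rmorphM, rmorphB, rmorphN) /=; by field.
Qed.

Lemma hurwitz0 : (0 : quat R) \in @hurwitz R.
Proof. by apply/hurwitz_combP; exists 0, 0, 0, 0; congr Quat; field. Qed.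

Lemma hurwitz1 : (1 : quat R) \in @hurwitz R.
Proof. by apply/hurwitz_combP; exists 2, (-1), (-1), (-1); congr Quat; field. Qed.

Lemma hurwitz_qnorm_int x : x \in @hurwitz R -> qnorm x \is a Num.int.
Proof.
move=> /hurwitz_combP[a [b [c [d ->]]]].
have -> : qnorm (hurwitz_comb a b c d) =
    (a * a + a * (b + c + d) + b * b + c * c + d * d)%:~R.
  by rewrite /qnorm !(rmorphD, rmorphM) /=; field.
exact: intr_int.
Qed.

Lemma hurwitz_qnorm_cases x : x \in @hurwitz R -> x != 0 ->
  qnorm x = 1 \/ 2 <= qnorm x.
Proof.
move=> /hurwitz_qnorm_int/intrP[m em] x0.
have : 0 < qnorm x.
  by rewrite lt_def qnorm_ge0 andbT; apply: contra x0 => /eqP/qnorm_eq0 ->.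
rewrite em ltr0z; case: m em => [[|[|m]]|m] // _ _; [by left | right].
by rewrite (ler_nat _ 2).
Qed.

(** It suffices to compare the distances from [c] to 0 and to the 24 Hurwitz
    units.  They confine [c] to the 24-cell where each |c_i| is at most 1/2 and
    the |c_i| sum to at most 1, so that
    |c|^2 = sum |c_i|^2 <= (sum |c_i|) / 2 <= 1/2. *)
Lemma voronoi_norm_le (c : quat R) :
  (forall n, n \in @hurwitz R -> qnorm c <= qnorm (c + n)) -> qnorm c <= 2^-1.
Proof.
move=> near0.
have coord (x : R) : - x *+ 2 <= 1 -> x *+ 2 <= 1 -> x ^+ 2 <= `|x| / 2.
  move=> h1 h2; rewrite -real_normK ?num_real // expr2 ler_wpM2l //.
  by case: (ger0P x) => _; lra.
have near a b e d : qnorm c <= qnorm (c + hurwitz_comb a b e d).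
  by apply: near0; apply/hurwitz_combP; exists a, b, e, d.
(* the eight units +-1, +-i, +-j, +-k *)
have c0 : q0 c ^+ 2 <= `|q0 c| / 2.
  by apply: coord; [move: (near 2 (-1) (-1) (-1)) | move: (near (-2) 1 1 1)];
    rewrite /qnorm !quatE /=; lra.
have c1 : q1 c ^+ 2 <= `|q1 c| / 2.
  by apply: coord; [move: (near 0 1 0 0) | move: (near 0 (-1) 0 0)];
    rewrite /qnorm !quatE /=; lra.
have c2 : q2 c ^+ 2 <= `|q2 c| / 2.
  by apply: coord; [move: (near 0 0 1 0) | move: (near 0 0 (-1) 0)];
    rewrite /qnorm !quatE /=; lra.
have c3 : q3 c ^+ 2 <= `|q3 c| / 2.
  by apply: coord; [move: (near 0 0 0 1) | move: (near 0 0 0 (-1))];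
    rewrite /qnorm !quatE /=; lra.
(* the sixteen units (+-1 +-i +-j +-k) / 2; each coordinate gets
   the sign opposite to that of the same coordinate of [c] *)
have csum : `|q0 c| + `|q1 c| + `|q2 c| + `|q3 c| <= 1.
  have sgn (x : R) : exists s : bool, `|x| = (-1) ^+ s * x.
    by case: (ger0P x) => _; [exists false | exists true];
      rewrite ?expr0 ?expr1 ?mul1r ?mulN1r.
  have [[s0 ->] [s1 ->]] := (sgn (q0 c), sgn (q1 c)).
  have [[s2 ->] [s3 ->]] := (sgn (q2 c), sgn (q3 c)).
  have := near ((s0 : nat)%:Z *+ 2 - 1) ((s1 : nat)%:Z - (s0 : nat)%:Z)
    ((s2 : nat)%:Z - (s0 : nat)%:Z) ((s3 : nat)%:Z - (s0 : nat)%:Z).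
  rewrite /qnorm !quatE /=.
  by case: s0; case: s1; case: s2; case: s3; rewrite /= ?expr0 ?expr1; lra.
rewrite /qnorm; lra.
Qed.

End Hurwitz.

(** * Greedy bases *)

Section Greedy.
Variable R : realType.
Implicit Types (u v a b : 'rV[quat R]_2) (n : quat R).

Lemma vnormE u : vnorm u = Num.sqrt (sqnorm u).
Proof.
by congr Num.sqrt; apply: eq_bigr => i _; rewrite sqr_sqrtr ?qnorm_ge0.
Qed.

Lemma vnorm_le u v : (vnorm u <= vnorm v) = (sqnorm u <= sqnorm v).
Proof. by rewrite !vnormE ler_sqrt // sqnorm_ge0. Qed.

(** With c the coordinate of [b] along [a] and B' the squared norm of the
    orthogonal part of [b], passing from [b] to [n1 *: a + n2 *: b] either
    at least doubles B', which outweighs the loss of the part c a, or multiplies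
    by a unit, which reduces to the greedy condition. *)
Lemma greedy_lower_bound a b n1 n2 : a != 0 -> greedy_basis a b ->
  n1 \in @hurwitz R -> n2 \in @hurwitz R -> n2 != 0 ->
  vnorm b <= vnorm (n1 *: a + n2 *: b).
Proof.
move=> a0 [leab greedy] Hn1 Hn2 n20.
have [c orth] := orth_projection b a0; have A0 := sqnorm_gt0 a0.
have normE := sqnorm_combination _ _ orth.
set A := sqnorm a in A0 normE; set B' := sqnorm (b - c *: a) in normE.
have B'0 : 0 <= B' by apply: sqnorm_ge0.
have qnorm1 : qnorm (1 : quat R) = 1 by rewrite /qnorm /=; ring.
have bE : sqnorm b = qnorm c * A + B'.
  by have := normE 0 1; rewrite scale0r scale1r !add0r mul1r qnorm1 mul1r.
have near0 n : n \in @hurwitz R -> qnorm c <= qnorm (c + n).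
  move=> /greedy; rewrite vnorm_le addrC.
  have := normE n 1; rewrite scale1r mul1r qnorm1 mul1r => ->.
  by rewrite bE lerD2r ler_pM2r // addrC.
have c_small := voronoi_norm_le near0.
rewrite vnorm_le normE bE; rewrite vnorm_le bE -/A in leab.
case: (hurwitz_qnorm_cases Hn2 n20) => [unit2|big2].
  (* the conjugate of a Hurwitz unit is its inverse *)
  have -> : qnorm (n1 + n2 * c) = qnorm (c + qconj n2 * n1).
    have n2K : qconj n2 * n2 = 1 by rewrite qconj_mul unit2.
    rewrite -[LHS]mul1r -[in LHS]unit2 -qnorm_conj -qnormM mulrDr mulrA n2K.
    by rewrite mul1r addrC.
  by rewrite unit2 mul1r lerD2r ler_pM2r // near0 // hurwitzM // hurwitz_conj.
(* A <= |c|^2 A + B' and |c|^2 <= 1/2 give |c|^2 A <= A / 2 <= B' *)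
have := qnorm_ge0 (n1 + n2 * c); have := qnorm_ge0 c; nra.
Qed.

Lemma hurwitz_scale_lower_bound n a : n \in @hurwitz R -> n != 0 ->
  vnorm a <= vnorm (n *: a).
Proof.
move=> Hn n0; rewrite vnorm_le sqnormZ ler_peMl ?sqnorm_ge0 //.
by case: (hurwitz_qnorm_cases Hn n0) => [->|] //; lra.
Qed.

End Greedy.

Theorem proposition24 (R : realType) (alpha beta : 'rV[quat R]_2)
  (Hindep : lin_indep alpha beta)
  (Hgreedy : greedy_basis alpha beta) :
  shortest_reduced_basis (hurwitz_lattice alpha beta) alpha beta.
Proof.
have alpha0 : alpha != 0.
  apply/eqP => alpha0; have [|/eqP] := Hindep 1 0.
    by rewrite alpha0 scaler0 scale0r addr0.
  by rewrite oner_eq0.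
split; first by [].
- split; first by exists 1, 0; rewrite hurwitz0 hurwitz1 scale1r scale0r addr0.
    exact/eqP.
  move=> v [n1 [n2 [Hn1 Hn2 ->]]] /eqP.
  have [-> | n20 _] := eqVneq n2 0.
    rewrite scale0r addr0; have [->|n10 _] := eqVneq n1 0.
      by rewrite scale0r eqxx.
    exact: hurwitz_scale_lower_bound.
  by apply: le_trans (greedy_lower_bound _ Hgreedy _ _ _); first case: Hgreedy.
- split; [by exists 0, 1; rewrite hurwitz0 hurwitz1 scale1r scale0r add0r | by [] |].
  move=> v [n1 [n2 [Hn1 Hn2 ->]]] indep; apply: greedy_lower_bound => //.
  apply/eqP => n20; move: indep; rewrite n20 scale0r addr0 => indep.
  have [|_ /eqP] := indep n1 (-1); first by rewrite scaleN1r subrr.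
  by rewrite oppr_eq0 oner_eq0.
Qed.
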